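(* Let $\omega_n=(s_1,\dots,s_N)$ be a uniform $n$-element sorting network, where $N=\binom n2$, and let $\mathbb P^n_{\mathrm U}$ be its law. Then for $1\le r\le n-1$, $$\mathbb P^n_{\mathrm U}(s_1=r)=\frac1N\cdot\frac{\big(3\cdot5\cdot7\cdots(2r-1)\big)\big(3\cdot5\cdots(2(n-r)-1)\big)}{\big(2\cdot4\cdot6\cdots(2r-2)\big)\big(2\cdot4\cdots(2(n-r)-2)\big)}.$$
   Context: Let $\mathcal S_n$ be the symmetric group of all permutations of $\{1,\ldots,n\}$, with composition $(\sigma\tau)(i)=\sigma(\tau(i))$. For $1\le s\le n-1$ let $\tau_s=(s\ \ s+1)\in\mathcal S_n$, and let $\rho=(n,n-1,\ldots,1)$ be the reverse permutation. Put $N=\binom n2$. An $n$-element sorting network is a sequence $\omega=(s_1,\ldots,s_N)$ of elements of $\{1,\dots,n-1\}$ such that $\tau_{s_1}\cdots\tau_{s_N}=\rho$. A uniform $n$-element sorting network is a uniformly distributed random element of the set of all $n$-element sorting networks. Empty products are equal to $1$. *)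

(* Defs.v *)
From mathcomp Require Import all_boot all_order all_algebra all_fingroup.

Set Implicit Arguments.
Unset Strict Implicit.
Unset Printing Implicit Defensive.

Import GRing.Theory.

(* The set {1, ..., n} permuted by S_n is encoded as 'I_n, with the point i
   represented by the ordinal i - 1.  The letters s in {1, ..., n-1} are not
   shifted: they are the nonzero elements of 'I_n. *)

(* The points s and s + 1 are the ordinals s - 1 and s.  For the letter 0, which
   is_sorting_network excludes, ord_pred wraps around. *)
Definition adj_tperm (n : nat) (s : 'I_n) : 'S_n := tperm (ord_pred s) s.

Definition rev_perm (n : nat) : 'S_n := perm (@rev_ord_inj n).

(* The product tau_{s_1} ... tau_{s_k} for (sigma tau)(i) = sigma (tau i).
   MathComp composes permutations in the opposite order (permM), hence rev. *)
Definition word_perm (n : nat) (w : seq 'I_n) : 'S_n :=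
  (\prod_(s <- rev w) adj_tperm s)%g.

Definition is_sorting_network (n : nat) (w : 'C(n, 2).-tuple 'I_n) : bool :=
  all (fun s : 'I_n => 0 < s) w && (word_perm w == rev_perm n).

Definition sorting_networks (n : nat) : {set 'C(n, 2).-tuple 'I_n} :=
  [set w | is_sorting_network w].

Definition uniform_law (T : finType) (S A : {set T}) : rat :=
  (#|A :&: S|%:R / #|S|%:R)%R.

Definition sorting_network_law (n : nat) :
    {set 'C(n, 2).-tuple 'I_n} -> rat :=
  uniform_law (sorting_networks n).

(* s_1 as a natural number; the default 0, which is not a letter, is returned
   only on the empty word, that is for n <= 1. *)
Definition first_letter (n : nat) (w : 'C(n, 2).-tuple 'I_n) : nat :=
  head 0 [seq val s | s <- w].

(* Main.v *)
Require Import Defs.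
From mathcomp Require Import all_boot all_order all_algebra all_fingroup.
From mathcomp Require Import zify ring.

Set Implicit Arguments.
Unset Strict Implicit.
Unset Printing Implicit Defensive.

Import GRing.Theory Num.Theory.

(** Why the theorem is true.  Deleting the first letter of a sorting network
    that starts with r leaves a reduced word of tau_r rho.  Hence the
    probability is f (tau_r rho) / f rho, where f v is the number of reduced
    words of v.  Both numbers turn out to be numbers of standard Young tableaux,
    of the staircase shape (n-1, ..., 2, 1) and of that shape with one corner
    removed, and the quotient of the two products of the hook length formula
    telescopes to the asserted one.

    No insertion algorithm is used to get the tableau count.  The proof rests
    instead on the transition formula: for a permutation u and a position r,
      sum of f (u t_ir) over i < r  =  sum of f (u t_rj) over j > r,
    the sums being over the transpositions that increase the number of
    inversions by exactly one (lemma transition).  It has a short proof by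
    induction on the number of inversions.  Remove the first letter from all the
    words on both sides: for a letter s that is a descent of u this gives the
    same formula for tau_s u, and for the other letters almost everything
    vanishes.  What remains are the terms in which s undoes t_ir or t_rj, and
    they cancel because s can move the value u r up or down by one.  This needs
    room above and below u r, which is why the permutations are padded by fixed
    points on both sides (pad); padding does not change f (num_words_pad).

    When each side has a single term, the formula says that two permutations
    have equally many reduced words.  A permutation that avoids 132, such as rho
    and tau_r rho, can be deformed in this way, one bump (bump_step) after the
    other, until it is Grassmannian, that is, increasing on the two sides of one
    position (bumpable_grassmannian).  A bump only permutes the entries of the
    Lehmer code, so the Grassmannian permutation is known: its code is the
    sorted code of the original one.

    For a Grassmannian permutation, removing the first letter means lowering one
    of the left values by one.  The resulting recursion is solved by the product
    of Frobenius, k! prod_(x < y) (l_y - l_x) / prod_x l_x!, by an interpolation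
    identity (sum_shifted_ratio).  For the codes of rho and tau_r rho the values
    l agree except that one is lowered by one, and the same lemma that drives
    the recursion (grassmannian_count_dec) evaluates the quotient. *)

(** * Words, inversions and the Lehmer code *)

(** The first letter acts last, hence on values: removing s from a word of v
    leaves a word of tau_s v, written v * adj_tperm s because products of
    permutations act from left to right.  Words of every length are counted, reduced or
    not; num_words_lt makes the non-reduced case harmless. *)
Fixpoint num_words n k (v : 'S_n) : nat :=
  if k is k'.+1 then \sum_(s : 'I_n | 0 < s) num_words k' (v * adj_tperm s)%g
  else (v == 1%g).

Definition code n (v : 'S_n) (x : 'I_n) : nat :=
  #|[set z : 'I_n | (x < z) && (v z < v x)]|.

Definition inversions n (v : 'S_n) : nat := \sum_x code v x.

Lemma inversionsE n (v : 'S_n) :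
  inversions v = #|[set p : 'I_n * 'I_n | (p.1 < p.2) && (v p.2 < v p.1)]|.
Proof.
rewrite /inversions -sum1_card.
under eq_bigr => x _ do rewrite /code -sum1_card.
by rewrite pair_big_dep /=; apply: eq_bigl => p; rewrite !inE.
Qed.

Lemma inversions1 n : inversions (1 : 'S_n)%g = 0.
Proof.
rewrite inversionsE; apply/eqP; rewrite cards_eq0; apply/eqP/setP => p.
by rewrite !inE !perm1; lia.
Qed.

Lemma inversionsV n (v : 'S_n) : inversions v^-1%g = inversions v.
Proof.
rewrite !inversionsE -(card_imset _ (_ : injective (fun p => (v^-1%g p.2, v^-1%g p.1)))); last first.
  by move=> [a b] [c d] [/perm_inj-> /perm_inj->].
apply: eq_card => p; rewrite !inE; apply/imsetP/idP.
  by case=> q; rewrite !inE => /andP[h1 h2] -> /=; rewrite !permKV h1 h2.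
move=> /andP[h1 h2]; exists (v p.2, v p.1); last by rewrite /= !permK -surjective_pairing.
by rewrite !inE /= !permK h1 h2.
Qed.

Lemma val_ord_pred n (s : 'I_n) : 0 < s -> ord_pred s = s.-1 :> nat.
Proof.
move=> s0 /=; have -> : (s + n).-1 = s.-1 + n by lia.
by rewrite modnDr modn_small //; have := ltn_ord s; lia.
Qed.

Lemma val_adj_tperm n (s x : 'I_n) : 0 < s ->
  adj_tperm s x = (if x == s.-1 :> nat then s : nat
                   else if x == s :> nat then s.-1 else x) :> nat.
Proof.
move=> s0; rewrite /adj_tperm; have Es := val_ord_pred s0.
case: tpermP => [->|->|h1 h2].
- by rewrite Es eqxx.
- by rewrite Es eqxx; case: eqP; lia.
case: eqP => [e|_]; first by case: h1; apply: val_inj; rewrite [RHS]Es.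
by case: eqP => [e|//]; case: h2; apply: val_inj.
Qed.

Lemma adj_tpermK n (s : 'I_n) (v : 'S_n) : (v * adj_tperm s * adj_tperm s)%g = v.
Proof. by rewrite -mulgA tperm2 mulg1. Qed.

(** The values s-1 and s are adjacent, so exchanging them changes the order of
    no other pair of values: the only new inversion is the pair (x, y). *)
Lemma inversions_adj n (s : 'I_n) (v : 'S_n) (x y : 'I_n) :
  0 < s -> v x = s.-1 :> nat -> v y = s :> nat -> x < y ->
  inversions (v * adj_tperm s)%g = (inversions v).+1.
Proof.
move=> s0 vx vy xy; rewrite !inversionsE.
pose A := [set p : 'I_n * 'I_n | (p.1 < p.2) && (v p.2 < v p.1)].
rewrite -/A.
have /negPf nA : (x, y) \notin A by rewrite inE /= vx vy; lia.
rewrite -[RHS]add1n -[1]/(nat_of_bool true) -[true]/(~~ false) -nA -cardsU1.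
apply: eq_card => -[a b]; rewrite !inE /= xpair_eqE !permM !val_adj_tperm //.
have ea c : (c == x) = (v c == s.-1 :> nat) by rewrite -vx val_eqE (inj_eq perm_inj).
have eb c : (c == y) = (v c == s :> nat) by rewrite -vy val_eqE (inj_eq perm_inj).
rewrite ea eb.
have [->|nab] := eqVneq a b; first by rewrite !ltnn /=; lia.
have nv : v a != v b :> nat by rewrite val_eqE (inj_eq perm_inj).
have h1 : (v a == s.-1 :> nat) -> (v b == s :> nat) -> a < b.
  by rewrite -ea -eb => /eqP-> /eqP->.
have h2 : (v a == s :> nat) -> (v b == s.-1 :> nat) -> b < a.
  by rewrite -ea -eb => /eqP-> /eqP->.
have nab' : a != b :> nat by [].
move: h1 h2.
by case: (v a =P s.-1 :> nat) => ?; case: (v a =P s :> nat) => ?;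
   case: (v b =P s.-1 :> nat) => ?; case: (v b =P s :> nat) => ? h1 h2;
   try have := h1 isT isT; try have := h2 isT isT; lia.
Qed.

Lemma leq_inversions_adj n (s : 'I_n) (v : 'S_n) : 0 < s ->
  inversions v <= (inversions (v * adj_tperm s)%g).+1.
Proof.
move=> s0; pose x := (v^-1)%g (ord_pred s); pose y := (v^-1)%g s.
have vx : v x = s.-1 :> nat by rewrite permKV val_ord_pred.
have vy : v y = s :> nat by rewrite permKV.
case: (ltngtP x y) => [xy|yx|/val_inj xy].
- by rewrite (inversions_adj s0 vx vy xy); lia.
- rewrite -{1}(adj_tpermK s v) (inversions_adj s0 _ _ yx) //.
  + by rewrite permM val_adj_tperm // vy eqxx; case: eqP; lia.
  + by rewrite permM val_adj_tperm // vx eqxx.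
- by move: vx; rewrite xy vy; lia.
Qed.

Lemma num_words_lt n k (v : 'S_n) : k < inversions v -> num_words k v = 0.
Proof.
elim: k v => [|k IH] v /= kv.
  by case: eqP kv => // ->; rewrite inversions1.
rewrite big1 // => s s0; apply: IH.
by have := leq_inversions_adj v s0; lia.
Qed.

(** Exchanging the values v x < v y is the same as exchanging v x + 1 and v y,
    conjugated by the adjacent transposition of v x and v x + 1.  The induction
    on the difference of the two values thus meets two more adjacent steps, whose
    signs depend only on whether the position z of v x + 1 lies before x,
    between x and y, or after y.  They are opposite, except that both are +1
    when z lies between x and y. *)
Lemma inversions_tperm_cover n d (v : 'S_n) (x y : 'I_n) :
  x < y -> v x < v y -> v y - v x <= d ->
  inversions v < inversions (tperm x y * v)%g /\
  ((forall z : 'I_n, x < z < y -> ~~ (v x < v z < v y)) ->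
   inversions (tperm x y * v)%g = (inversions v).+1).
Proof.
elim: d v => [|d IH] v xy vxy dv; first lia.
have s_lt : (v x).+1 < n by have := ltn_ord (v y); lia.
pose s := Ordinal s_lt; have s0 : 0 < s by [].
have vx : v x = s.-1 :> nat by [].
have [e|ne] := eqVneq (v y : nat) s.
  have -> : (tperm x y * v)%g = (v * adj_tperm s)%g.
    apply/permP => z; rewrite !permM /=; apply: val_inj.
    rewrite [RHS]val_adj_tperm //=; case: tpermP => [->|->|zx zy].
    - by rewrite eqxx e.
    - by rewrite e eqxx; case: eqP.
    - case: eqP => [/val_inj/perm_inj //|_].
      by case: eqP => // e'; case: zy; apply: (@perm_inj _ v); apply: val_inj; rewrite /= e' e.
  by rewrite (inversions_adj s0 vx e xy).
pose z := (v^-1)%g s; have vz : v z = s :> nat by rewrite permKV.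
have zx : z != x by apply/eqP => h; move: vz; rewrite h /=; lia.
have zy : z != y by apply/eqP => h; move: ne; rewrite -vz h eqxx.
pose w := (v * adj_tperm s)%g.
have wE u : w u = (if v u == s.-1 :> nat then s : nat
                   else if v u == s :> nat then s.-1 else v u) :> nat.
  by rewrite permM val_adj_tperm.
have wx : w x = s :> nat by rewrite wE vx eqxx.
have wz : w z = s.-1 :> nat by rewrite wE vz eqxx; case: eqP => //=; lia.
have wy : w y = v y :> nat by rewrite wE (negPf ne); case: eqP => //=; lia.
have wK : v = (w * adj_tperm s)%g by rewrite adj_tpermK.
have twK : (tperm x y * v = tperm x y * w * adj_tperm s)%g by rewrite wK -!mulgA.
have tvK : (tperm x y * w = tperm x y * v * adj_tperm s)%g by rewrite -!mulgA.
have [] := IH w xy; first by rewrite wx wy; move: ne => /=; lia.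
  by rewrite wx wy /=; lia.
move=> lt_w eq_w.
have tz : tperm x y z = z by rewrite tpermD // eq_sym.
have {}eq_w : (forall z : 'I_n, x < z < y -> ~~ (v x < v z < v y)) ->
   inversions (tperm x y * w)%g = (inversions w).+1.
  move=> H; apply: eq_w => z' hz'; have := H _ hz'; rewrite wx wy wE /=.
  by case: eqP => ?; [lia|case: eqP => ?; lia].
have nz : z < x \/ x < z.
  by move: zx; rewrite -val_eqE /=; lia.
have nzy : z < y \/ y < z.
  by move: zy; rewrite -val_eqE /=; lia.
have h1 : if z < x then inversions v = (inversions w).+1
          else inversions w = (inversions v).+1.
  case: ltnP => hz; first by rewrite {1}wK; exact: (@inversions_adj _ s w z x).
  by apply: (@inversions_adj _ s v x z) => //; lia.
have h2 : if z < y then inversions (tperm x y * v)%g = (inversions (tperm x y * w)%g).+1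
          else inversions (tperm x y * w)%g = (inversions (tperm x y * v)%g).+1.
  case: ltnP => hz.
    by rewrite twK; apply: (@inversions_adj _ s _ z y); rewrite // permM ?tpermR ?tz.
  by rewrite tvK; apply: (@inversions_adj _ s _ y z); rewrite ?permM ?tpermR ?tz //; lia.
split.
  by move: h1 h2; case: ifP; case: ifP; lia.
move=> H; have := eq_w H; have := H z; rewrite vz.
by move: h1 h2; case: ifP => a1; case: ifP => a2 /=; lia.
Qed.

Lemma inversions_tperm n (v : 'S_n) (x y : 'I_n) : x < y -> v x < v y ->
  inversions v < inversions (tperm x y * v)%g.
Proof. by move=> xy vxy; case: (inversions_tperm_cover xy vxy (leqnn _)). Qed.

Lemma inversions_cover n (v : 'S_n) (x y : 'I_n) : x < y -> v x < v y ->
  (forall z : 'I_n, x < z < y -> ~~ (v x < v z < v y)) ->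
  inversions (tperm x y * v)%g = (inversions v).+1.
Proof. by move=> xy vxy; case: (inversions_tperm_cover xy vxy (leqnn _)). Qed.

(** The three entries go from order abc to cba through acb and cab, each step
    creating an inversion. *)
Lemma inversions_noncover n (v : 'S_n) (x z y : 'I_n) : x < z < y ->
  v x < v z < v y -> (inversions v).+1 < inversions (tperm x y * v)%g.
Proof.
move=> /andP[xz zy] /andP[vxz vzy].
have xz' : x != z by apply/eqP => e; move: xz; rewrite e ltnn.
have zy' : z != y by apply/eqP => e; move: zy; rewrite e ltnn.
have xy' : x != y by apply/eqP => e; move: zy xz; rewrite e; lia.
have -> : (tperm x y * v = tperm z y * (tperm x z * (tperm z y * v)))%g.
  apply/permP => a; rewrite !permM; congr (v _).
  case: (tpermP x y a) => [->|->|/eqP ax /eqP ay].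
  - by rewrite (@tpermD _ z y x) 1?eq_sym // tpermL tpermL.
  - by rewrite tpermR tpermR (@tpermD _ z y x) 1?eq_sym.
  - have [->|az] := eqVneq a z; first by rewrite tpermL (@tpermD _ x z y) // tpermR.
    by rewrite !tpermD // eq_sym.
have E1 : (tperm z y * v)%g x = v x by rewrite permM tpermD // eq_sym.
have E2 : (tperm z y * v)%g z = v y by rewrite permM tpermL.
have E3 : (tperm z y * v)%g y = v z by rewrite permM tpermR.
have h1 := inversions_tperm zy vzy.
have h2 : inversions (tperm z y * v)%g < inversions (tperm x z * (tperm z y * v))%g.
  by apply: inversions_tperm; rewrite // E1 E2; lia.
have h3 : inversions (tperm x z * (tperm z y * v))%g <
   inversions (tperm z y * (tperm x z * (tperm z y * v)))%g.
  apply: inversions_tperm; rewrite // permM tpermR E1 permM tpermD // E3 //.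
lia.
Qed.

(** * The transition formula *)

(** The coefficient of u t_ir in the difference of the two sides of the
    transition formula.  The condition selects all transpositions that create
    inversions; those that create more than one drop out of transition_sum by
    themselves, since no word of the relevant length spells the product. *)
Definition transition_sign n (v : 'S_n) (r i : 'I_n) : int :=
  if (i != r) && ((i < r) == (v i < v r)) then if i < r then 1%R else (-1)%R
  else 0%R.

Definition transition_sum n k (v : 'S_n) (r : 'I_n) : int :=
  (\sum_i transition_sign v r i * (num_words k (tperm i r * v)%g)%:Z)%R.

Lemma val_eq_perm n (v : 'S_n) x y : (v x == v y :> nat) = (x == y).
Proof. by rewrite val_eqE (inj_eq perm_inj). Qed.

(** Exchanging the values s-1 and s can change the relative order of the entries
    in positions i and r only if these entries are s-1 and s. *)
Lemma transition_sign_adj n (s : 'I_n) (v : 'S_n) (r i : 'I_n) : 0 < s ->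
  transition_sign (v * adj_tperm s)%g r i = transition_sign v r i \/
  [/\ i != r & (v i = s.-1 :> nat /\ v r = s :> nat) \/
               (v i = s :> nat /\ v r = s.-1 :> nat)].
Proof.
move=> s0; rewrite /transition_sign; have [->|ir] := eqVneq i r; first by left.
have := val_eq_perm v i r; rewrite (negPf ir) => nv.
rewrite !permM !val_adj_tperm //.
case: (v i =P s.-1 :> nat) => a1; case: (v r =P s :> nat) => a2; try by right; split; auto.
all: case: (v i =P s :> nat) => a3; case: (v r =P s.-1 :> nat) => a4; try by right; split; auto.
all: left; rewrite /=; do ?[congr (if _ then _ else _)]; try lia.
Qed.

(** The words that start with s.  The difference between the two sides comes
    from the single position i for which tau_s undoes t_ir; the result is then v
    itself, and its coefficient depends only on whether s moves the value v r
    down or up. *)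
Lemma transition_sum_adj n k (s : 'I_n) (v : 'S_n) (r : 'I_n) : 0 < s ->
  (\sum_i transition_sign v r i * (num_words k (tperm i r * v * adj_tperm s)%g)%:Z =
   transition_sum k (v * adj_tperm s)%g r
   + ((s == v r :> nat)%:Z - (s.-1 == v r :> nat)%:Z) * (num_words k v)%:Z)%R.
Proof.
move=> s0; rewrite /transition_sum.
pose D i := (transition_sign v r i - transition_sign (v * adj_tperm s)%g r i)%R.
have tK i : [/\ i != r & (v i = s.-1 :> nat /\ v r = s :> nat) \/
               (v i = s :> nat /\ v r = s.-1 :> nat)] -> (tperm i r * v * adj_tperm s)%g = v.
  move=> [ir H]; apply/permP => x; apply: val_inj; rewrite !permM /= val_adj_tperm //.
  case: tpermP => [->|->|xi xr].
  - by case: H => -[-> ->]; rewrite eqxx //; case: eqP => //; lia.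
  - by case: H => -[-> ->]; rewrite eqxx //; case: eqP => //; lia.
  - have : v x != v i :> nat by rewrite val_eq_perm; apply/eqP.
    have : v x != v r :> nat by rewrite val_eq_perm; apply/eqP.
    by case: H => -[-> ->] /negPf-> /negPf->.
have -> : (((s == v r :> nat)%:Z - (s.-1 == v r :> nat)%:Z) * (num_words k v)%:Z
   = \sum_i D i * (num_words k v)%:Z)%R.
  rewrite -mulr_suml; congr (_ * _)%R.
  have e1 : (s.-1 == s :> nat) = false by lia.
  have e1' : (s == s.-1 :> nat) = false by lia.
  have e2 : (s.-1 < s) = true by lia.
  have e3 : (s == s.-1 :> nat) = false by lia.
  have e4 : (s < s.-1) = false by lia.
  have D0 i : ~ [/\ i != r & (v i = s.-1 :> nat /\ v r = s :> nat) \/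
               (v i = s :> nat /\ v r = s.-1 :> nat)] -> D i = 0%R.
    by rewrite /D; case: (transition_sign_adj v r i s0) => [->|//]; rewrite subrr.
  have key i0 : v i0 != v r :> nat ->
     (v i0 = s.-1 :> nat /\ v r = s :> nat) \/ (v i0 = s :> nat /\ v r = s.-1 :> nat) ->
     (\sum_i D i)%R = D i0.
    move=> n0 H; rewrite (bigD1 i0) //= big1 ?addr0 // => i ii0; apply: D0 => -[ir H'].
    have : v i != v i0 :> nat by rewrite val_eq_perm.
    by case: H H' => -[-> e] [] [-> e']; rewrite ?eqxx //; lia.
  case: eqP => [e|ne].
    have vi : v ((v^-1)%g (ord_pred s)) = s.-1 :> nat by rewrite permKV val_ord_pred.
    rewrite (key _ _ (or_introl (conj vi (esym e)))); last by rewrite vi -e; lia.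
    move: ((v^-1)%g (ord_pred s)) vi => i vi.
    have ir : i != r by rewrite -(val_eq_perm v) vi -e; lia.
    have ir' : i != r :> nat by [].
    rewrite /D /transition_sign ir /= !permM !val_adj_tperm // vi -e eqxx.
    by rewrite e1 e2 e3 eqxx e4; case: (i < r).
  case: eqP => [e|ne']; last first.
    by rewrite big1 // => i _; apply: D0; lia.
  have vi : v ((v^-1)%g s) = s :> nat by rewrite permKV.
  rewrite (key _ _ (or_intror (conj vi (esym e)))); last by rewrite vi -e; lia.
  move: ((v^-1)%g s) vi => i vi.
  have ir : i != r by rewrite -(val_eq_perm v) vi -e; lia.
  have ir' : i != r :> nat by [].
  rewrite /D /transition_sign ir /= !permM !val_adj_tperm // vi -e eqxx.
  by rewrite e1' !eqxx e2 e4; case: (i < r).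
rewrite -big_split; apply: eq_bigr => i _ /=.
case: (transition_sign_adj v r i s0) => [e|/tK e].
  by rewrite /D e subrr mul0r addr0 mulgA.
by rewrite mulgA e -mulrDl /D addrC subrK.
Qed.

(** The margin k on both sides of v r survives the induction, since removing a
    letter moves v r by at most one while k decreases by one. *)
Lemma transition n k (v : 'S_n) (r : 'I_n) :
  inversions v = k -> k < v r -> v r + k < n.-1 -> transition_sum k.+1 v r = 0%R.
Proof.
elim/ltn_ind: k v => k IH v kv kr rk.
rewrite /transition_sum /=.
under eq_bigr => i _ do rewrite (big_morph Posz PoszD (erefl _)) mulr_sumr.
rewrite exchange_big /=.
under eq_bigr => s s0 do rewrite transition_sum_adj //.
rewrite big_split /= -mulr_suml.
have rp : (v r).+1 < n by lia.
have rr : v r < n by lia.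
(* Exactly one letter moves v r down and exactly one moves it up. *)
rewrite [X in (_ + X * _)%R](_ : _ = 0%R) ?mul0r ?addr0; last first.
  rewrite sumrB (bigD1 (v r)) /=; last by lia.
  rewrite eqxx big1 ?addr0; last first.
    by move=> s /andP[_ /negPf]; rewrite -val_eqE /= => ->.
  rewrite (bigD1 (Ordinal rp)) //= eqxx big1 ?addr0 ?subrr // => s /andP[s0].
  by rewrite -val_eqE /=; case: eqP; lia.
apply: big1 => s s0.
pose x := (v^-1)%g (ord_pred s); pose y := (v^-1)%g s.
have vx : v x = s.-1 :> nat by rewrite permKV val_ord_pred.
have vy : v y = s :> nat by rewrite permKV.
have vs a : (v * adj_tperm s)%g a = (if v a == s.-1 :> nat then s : nat
                   else if v a == s :> nat then s.-1 else v a) :> nat.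
  by rewrite permM val_adj_tperm.
case: (ltngtP x y) => [xy|yx|/val_inj xy]; last by move: vx; rewrite xy vy; lia.
- have E := inversions_adj s0 vx vy xy.
  rewrite /transition_sum big1 // => i _; rewrite /transition_sign.
  case: ifP => [/andP[ir /eqP h]|]; rewrite ?mul0r //.
  rewrite num_words_lt ?mulr0 // -kv -E; apply: ltnW.
  case: (ltngtP i r) h => [lt_ir|lt_ri|/val_inj/eqP]; last by rewrite (negPf ir).
    by move=> /esym; apply: inversions_tperm.
  move=> /esym/negbT; rewrite -leqNgt => h; rewrite tpermC; apply: inversions_tperm => //.
  by rewrite ltn_neqAle h andbT val_eq_perm eq_sym.
- have E : inversions v = (inversions (v * adj_tperm s)%g).+1.
    rewrite -{1}(adj_tpermK s v); apply: (inversions_adj s0 _ _ yx).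
    + by rewrite vs vy eqxx; case: eqP; lia.
    + by rewrite vs vx eqxx.
  have -> : k = (inversions (v * adj_tperm s)%g).+1 by rewrite -E.
  apply: IH => //; first by rewrite -kv E.
    by rewrite vs; do ?case: ifP => ?; lia.
  by rewrite vs; do ?case: ifP => ?; lia.
Qed.

(** If i is both the last position before r with a value below u r and the one
    with the largest such value, then every other t_xr with x < r jumps over the
    entry in position i, so that it has no reduced word of length k + 1; the same
    holds for j on the right. *)
Lemma transition_unique n k (u : 'S_n) (i r j : 'I_n) :
  inversions u = k -> k < u r -> u r + k < n.-1 ->
  i < r -> r < j -> u i < u r -> u r < u j ->
  (forall x : 'I_n, x < r -> u x < u r -> x <= i /\ u x <= u i) ->
  (forall x : 'I_n, r < x -> u r < u x -> j <= x /\ u j <= u x) ->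
  num_words k.+1 (tperm i r * u)%g = num_words k.+1 (tperm r j * u)%g.
Proof.
move=> ku kr rk ir rj uir urj Hi Hj.
have := transition ku kr rk; rewrite /transition_sum.
have [m Em] : exists m, m = k.+1 by exists k.+1.
rewrite -Em.
have ij : i != j by rewrite -val_eqE /=; lia.
have ji : j != i by rewrite eq_sym.
have Si : transition_sign u r i = 1%R.
  by rewrite /transition_sign ir uir -val_eqE /=; case: eqP => //; lia.
have Sj : transition_sign u r j = (-1)%R.
  rewrite /transition_sign -val_eqE /=; case: eqP => /=; first lia.
  by rewrite !ltnNge (ltnW rj) (ltnW urj).
rewrite (bigD1 i) //= (bigD1 j) //= Si Sj (tpermC j r).
rewrite big1 ?addr0 => [|x /andP[xi xj]].
  by rewrite mul1r mulN1r => /eqP; rewrite subr_eq0 => /eqP [].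
rewrite /transition_sign; case: ifP => [/andP[xr /eqP h]|]; rewrite ?mul0r //.
have nx : u x != u i :> nat by rewrite val_eq_perm.
have nx' : u x != u j :> nat by rewrite val_eq_perm.
have nxr : u x != u r :> nat by rewrite val_eq_perm.
move: xi xj xr; rewrite -!val_eqE /= => xi xj xr.
rewrite num_words_lt ?mulr0 // Em -ku.
have [lt|ge] := ltnP x r.
  have [] := Hi x lt; first by rewrite -h.
  by move=> h1 h2; apply: (@inversions_noncover _ u x i r); lia.
have [] := Hj x; try lia.
by move=> h1 h2; rewrite tpermC; apply: (@inversions_noncover _ u r j x); lia.
Qed.

(** * Bumping a permutation to a Grassmannian one *)

Lemma card_ord_lt n (m : 'I_n) : #|[set z : 'I_n | z < m]| = m.
Proof.
rewrite cardsE -sum1_card.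
by rewrite -(big_ord_widen n (fun=> 1)) ?sum1_card ?card_ord // ltnW.
Qed.

(** The displacement of a point is at most the number of inversions; this is how
    the margins demanded by the transition formula are found. *)
Lemma leq_perm_inversions n (v : 'S_n) (y : 'I_n) : v y <= y + inversions v.
Proof.
have E : #|[set z | v z < v y]| = v y.
  rewrite -[RHS](card_ord_lt (v y)) -[RHS](card_preimset _ (@perm_inj _ v)).
  by apply: eq_card => z; rewrite !inE.
have h1 : #|[set z | v z < v y]| <= #|[set z : 'I_n | z < y]| + code v y.
  rewrite /code -cardsUI; apply: (leq_trans _ (leq_addr _ _)).
  apply/subset_leq_card/subsetP => z; rewrite !inE => h; rewrite h andbT.
  by have [//|//|/val_inj e] := ltngtP z y; rewrite e ltnn in h.
have h2 : code v y <= inversions v by rewrite /inversions (bigD1 y) //= leq_addr.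
by move: h1; rewrite E card_ord_lt; lia.
Qed.

Lemma leq_inversions_perm n (v : 'S_n) (y : 'I_n) : y <= v y + inversions v.
Proof. by have := leq_perm_inversions v^-1 (v y); rewrite permK inversionsV. Qed.

(** A permutation that is bumped towards a Grassmannian one: positions below p
    are already merged into the increasing left part, positions from r on into
    the increasing right part, and the entries still to be treated sit in
    between.  The avoidance of 132 there is what makes the transition formula
    have a single term on the left. *)
Definition bumpable n p r (v : 'S_n) : Prop :=
  [/\ forall x y : 'I_n, x < y < p -> v x < v y,
      forall x y : 'I_n, r <= x < y -> v x < v y
    & forall x y z : 'I_n, p <= x < y -> y < r -> y < z -> ~~ (v x < v z < v y)].

Lemma perm_neq n (v : 'S_n) (x y : 'I_n) : x < y \/ y < x -> v x <> v y :> nat.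
Proof. by move=> h /eqP; rewrite val_eq_perm -val_eqE /=; lia. Qed.

(** The entry in position q, the last one still to be treated, is exchanged with
    the largest smaller value on its right, in position j, which removes one
    inversion; the value that arrives in position q is then exchanged with the
    largest smaller value on its left, in position i, which creates one again
    and gives v'.  The avoidance of 132 forces i < p: every untreated entry is larger
    than v j.  The two code entries in positions i and q are exchanged, the
    others stay. *)
Lemma bump_step n p (q : 'I_n) (v : 'S_n) (j0 : 'I_n) :
  p <= q -> bumpable p q.+1 v -> q < j0 -> v j0 < v q ->
  (inversions v).*2 <= p -> q + (inversions v).*2 < n ->
  exists v' i, [/\ bumpable p q.+1 v', v' q < v q,
    num_words (inversions v) v' = num_words (inversions v) v &
    forall x, code v' x = code v (tperm i q x)].
Proof.
move=> pq [inc_l inc_r av] qj0 vj0 Np Nq.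
case: (@arg_maxnP _ j0 (fun j => (q < j) && (v j < v q)) val) => [|j /andP[qj vj] jmax].
  by rewrite qj0.
have {}jmax (x : 'I_n) : q < x -> v x < v q -> x <= j.
  by move=> h1 h2; apply: jmax; rewrite h1 h2.
have Hc1 := leq_inversions_perm v j; have Hc2 := leq_perm_inversions v q.
pose u := (tperm q j * v)%g.
have nq : q != j by rewrite -val_eqE /=; lia.
have uq : u q = v j by rewrite permM tpermL.
have uj : u j = v q by rewrite permM tpermR.
have uo (x : 'I_n) : x <> q :> nat -> x <> j :> nat -> u x = v x.
  by move=> h1 h2; rewrite permM tpermD // -val_eqE eq_sym; apply/eqP.
have vu : v = (tperm q j * u)%g by rewrite mulgA tperm2 mul1g.
have mid (x : 'I_n) : p <= x < q -> v j < v x.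
  move=> /andP[px xq]; have h := av x q j; have h' : v x <> v j :> nat by apply: perm_neq; lia.
  by have := h; rewrite px xq ltnS leqnn qj vj andbT => /(_ isT isT isT); lia.
have right (x : 'I_n) : q < x -> v x < v q -> v x <= v j.
  move=> h1 h2; have := jmax _ h1 h2; rewrite leq_eqVlt => /orP[/eqP/val_inj->//|h].
  by apply: ltnW; apply: inc_r; lia.
have inv_u : inversions v = (inversions u).+1.
  rewrite {1}vu; apply: inversions_cover; rewrite ?uq ?uj // => z /andP[qz zj].
  rewrite uo; try lia; apply/negP => /andP[h1 h2].
  by have := right z qz h2; lia.
have n0 : 0 < n by have := ltn_ord q; lia.
(* Position 0 carries a value below v j, by the bound on displacements, so that
   there is a position to choose i from. *)
pose i0 : 'I_n := Ordinal n0.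
have Hi0 := leq_perm_inversions v i0; rewrite /= add0n in Hi0.
case: (@arg_maxnP _ i0 (fun i => (i < p) && (v i < v j)) val) => [/=|i /andP[ip vi] imax].
  by apply/andP; split; lia.
have {}imax (x : 'I_n) : x < p -> v x < v j -> x <= i.
  by move=> h1 h2; apply: imax; rewrite h1 h2.
have left (x : 'I_n) : i < x < q -> v j < v x.
  move=> /andP[ix xq]; case: (ltnP x p) => xp; last by apply: mid; rewrite xp.
  have h' : v x <> v j :> nat by apply: perm_neq; lia.
  by have := imax x xp; lia.
have viq : v i < v q by lia.
pose v' := (tperm i q * u)%g.
have v'i : v' i = v j by rewrite permM tpermL.
have v'q : v' q = v i by rewrite permM tpermR uo //; lia.
have v'j : v' j = v q by rewrite permM tpermD // -val_eqE /=; lia.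
have v'o (x : 'I_n) : x <> i :> nat -> x <> q :> nat -> x <> j :> nat -> v' x = v x.
  move=> h1 h2 h3; rewrite permM tpermD ?uo //; rewrite -val_eqE eq_sym; exact/eqP.
have inc_r' (x y : 'I_n) : q < x < y -> v' x < v' y.
  move=> /andP[qx xy]; have := inc_r x y; rewrite qx xy => /(_ isT) vxy.
  have [/val_inj ex|nx] := eqVneq (x : nat) j.
    have := right y; have h' : v y <> v q :> nat by apply: perm_neq; lia.
    by rewrite ex in xy vxy *; rewrite v'j v'o; lia.
  have [/val_inj ey|ny] := eqVneq (y : nat) j.
    by rewrite ey in xy vxy *; rewrite v'j v'o; lia.
  by rewrite !v'o; lia.
exists v', i; split.
- split.
  + move=> x y /andP[xy yp]; have := inc_l x y; rewrite xy yp => /(_ isT) vxy.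
    have [/val_inj ey|ny] := eqVneq (y : nat) i.
      by rewrite ey in xy vxy *; rewrite v'i v'o; lia.
    have [/val_inj ex|nx] := eqVneq (x : nat) i.
      by rewrite ex in xy *; rewrite v'i v'o; try lia; apply: left; lia.
    by rewrite !v'o; lia.
  + exact: inc_r'.
  + move=> x y z /andP[px xy] yq yz; apply/negP.
    have := mid x; have -> : v' x = v x by apply: v'o; lia.
    rewrite px /= => /(_ ltac:(lia)) hx.
    have [/val_inj ey|ny] := eqVneq (y : nat) q; first by rewrite ey v'q; lia.
    have -> : v' y = v y by apply: v'o; lia.
    have [/val_inj ez|nz] := eqVneq (z : nat) q; first by rewrite ez v'q; lia.
    have [/val_inj ez'|nz'] := eqVneq (z : nat) j.
      by rewrite ez' v'j; apply/negP; apply: av; lia.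
    have -> : v' z = v z by apply: v'o; lia.
    by apply/negP; apply: av; lia.
- by rewrite v'q.
- rewrite [X in _ = num_words _ X]vu inv_u; apply: transition_unique; rewrite ?uq ?uj //; try lia.
  + by rewrite uo; lia.
  + move=> x xq; have [xp|px] := ltnP x p; last by rewrite uo; try lia; have := mid x; lia.
    rewrite !uo; try lia; move=> h; have hi := imax x xp h.
    have [/val_inj->//|h'] : x = i :> nat \/ x < i by lia.
    split=> //.
    by apply: ltnW; apply: inc_l; lia.
  + move=> x qx; have [/val_inj->|nx] := eqVneq (x : nat) j; first by rewrite uj !leqnn.
    rewrite uo; try lia; move=> h.
    have hx : v x <> v q :> nat by apply: perm_neq; lia.
    have := inc_r x j; have := right x; lia.
- move=> x; have [/val_inj->|nxi] := eqVneq (x : nat) i.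
    rewrite tpermL /code v'i -[RHS](card_preimset _ (@perm_inj _ (tperm q j))).
    apply: eq_card => z; rewrite !inE; case: tpermP => [->|->|nzq nzj].
    + by rewrite v'q qj; lia.
    + by rewrite v'j; lia.
    + have nq' : z <> q :> nat by move=> /val_inj/nzq.
      have nj' : z <> j :> nat by move=> /val_inj/nzj.
      have [/val_inj->|nzi] := eqVneq (z : nat) i; first lia.
      have Hl := left z; have Hr := right z; have := perm_neq (v := v) (x := z) (y := j).
      by rewrite v'o //; [lia|exact/eqP].
  have [/val_inj->|nxq] := eqVneq (x : nat) q.
    rewrite tpermR /code v'q; apply: eq_card => z; rewrite !inE.
    have [/val_inj->|nzi] := eqVneq (z : nat) i; first by rewrite !ltnn /=; lia.
    have [/val_inj->|nzq] := eqVneq (z : nat) q; first by rewrite v'q !ltnn /=; lia.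
    have [/val_inj->|nzj] := eqVneq (z : nat) j; first by rewrite v'j; lia.
    rewrite v'o; try exact/eqP.
    by have := left z; have := inc_l i z; lia.
  rewrite tpermD -?val_eqE; try by rewrite /= eq_sym.
  have [qx|xq] := ltnP q x.
    rewrite /code; apply: eq_card => z; rewrite !inE.
    have [xz|//] := ltnP x z.
    have h1 : v x < v z by apply: inc_r; rewrite qx.
    have h2 : v' x < v' z by apply: inc_r'; rewrite qx.
    by rewrite !ltnNge (ltnW h1) (ltnW h2).
  have vx : v' x = v x by apply: v'o; lia.
  rewrite /code vx; have [xi|ix] := ltnP x i.
    apply: eq_card => z; rewrite !inE.
    have vxi : v x < v i by apply: inc_l; lia.
    have [/val_inj->|nzi] := eqVneq (z : nat) i; first by rewrite v'i; lia.
    have [/val_inj->|nzq] := eqVneq (z : nat) q; first by rewrite v'q; lia.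
    have [/val_inj->|nzj] := eqVneq (z : nat) j; first by rewrite v'j; lia.
    by rewrite v'o //; exact/eqP.
  have vxj := left x; rewrite -[RHS](card_preimset _ (@perm_inj _ (tperm q j))).
  apply: eq_card => z; rewrite !inE; case: tpermP => [->|->|nzq nzj].
  + by rewrite v'q; lia.
  + by rewrite v'j; lia.
  + have [/val_inj->|nzi] := eqVneq (z : nat) i; first lia.
    by rewrite v'o //; [exact/eqP|move=> /val_inj/nzq|move=> /val_inj/nzj].
Qed.

Lemma code_inversions n (v w : 'S_n) (t : 'S_n) :
  (forall x, code v x = code w (t x)) -> inversions v = inversions w.
Proof.
by move=> H; rewrite /inversions [RHS](reindex_perm t); apply: eq_bigr.
Qed.

(** Each bump lowers the value in the last untreated position, until it is smaller
    than everything on its right; it then belongs to the right part, and r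
    decreases. *)
Lemma bumpable_grassmannian n p r (v : 'S_n) : p <= r -> bumpable p r v ->
  (inversions v).*2 <= p -> r + (inversions v).*2 <= n ->
  exists v' (t : 'S_n), [/\ bumpable p p v',
    num_words (inversions v) v' = num_words (inversions v) v &
    forall x, code v' x = code v (t x)].
Proof.
have stop (w : 'S_n) : bumpable p p w -> exists v' (t : 'S_n), [/\ bumpable p p v',
    num_words (inversions w) v' = num_words (inversions w) w &
    forall x, code v' x = code w (t x)].
  by move=> Bw; exists w, 1%g; split=> // x; rewrite perm1.
elim: r v => [|r IHr] v; first by rewrite leqn0 => /eqP p0 Bv; subst p => _ _; apply: stop.
rewrite leq_eqVlt => /orP[/eqP<- Bv _ _|pr]; first exact: stop.
move=> Bv Np Nr; have rn : r < n by lia.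
pose q := Ordinal rn.
have [m] : exists m, v q < m by exists (v q).+1.
elim: m v Bv Np Nr => // m IHm v Bv Np Nr vm.
have [/existsP[j /andP[qj vj]]|noj] := boolP [exists j : 'I_n, (q < j) && (v j < v q)].
  have [|w [i [Bw wq Ew Cw]]] := @bump_step n p q v j pr Bv qj vj Np; first by rewrite /=; lia.
  have Iw := code_inversions Cw.
  rewrite -Iw in Np Nr Ew; have wm : w q < m by apply: leq_trans wq vm.
  have [v' [t [Bv' Ev' Cv']]] := IHm w Bw Np Nr wm.
  exists v', (t * tperm i q)%g; split=> //; first by rewrite -Iw -Ew.
  by move=> x; rewrite Cv' Cw permM.
apply: IHr => //; last lia.
have [inc_l inc_r av] := Bv; split=> //.
- move=> x y /andP[rx xy]; have [/val_inj ex|nx] := eqVneq (x : nat) q; last first.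
    by apply: inc_r; rewrite xy andbT /=; move: nx => /=; lia.
  move/existsPn: noj => /(_ y); rewrite -ex xy /= -leqNgt.
  by rewrite leq_eqVlt val_eq_perm -val_eqE /=; lia.
- by move=> x y z h1 h2; apply: av; lia.
Qed.

(** * The Frobenius product and its recursion *)

Local Open Scope ring_scope.


(** Both sides of the Lagrange interpolation formula, at their top coefficient. *)
Lemma coef_lagrange (F : fieldType) p (l : 'I_p -> F) (R : {poly F}) :
  injective l -> (size R <= p)%N ->
  R`_p.-1 = \sum_x R.[l x] / \prod_(y | y != x) (l x - l y).
Proof.
move=> l_inj sR.
pose L x := \prod_(y | y != x) ('X - (l y)%:P).
have sL x : size (L x) = p.
  rewrite /L -big_filter size_prod_XsubC size_filter.
  have := cardC1 x; rewrite card_ord cardE size_filter => h.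
  rewrite -[RHS](ltn_predK (ltn_ord x)) -h; congr (_.+1); exact: eq_count.
have coefL x : (L x)`_p.-1 = 1.
  have /eqP := monic_prod_XsubC (index_enum 'I_p) (fun y => y != x) l.
  by rewrite -/(L x) lead_coefE sL.
have prod_ne0 x : \prod_(y | y != x) (l x - l y) != 0.
  by apply/prodf_neq0 => y yx; rewrite subr_eq0 (inj_eq l_inj) eq_sym.
have [c cE] : exists c, forall x, c x = R.[l x] / \prod_(y | y != x) (l x - l y).
  by exists (fun x => R.[l x] / \prod_(y | y != x) (l x - l y)).
pose D := R - \sum_x c x *: L x.
have D0 : D = 0.
  apply: (@roots_geq_poly_eq0 _ D (codom l)).
  - apply/allP => _ /codomP[x ->]; rewrite rootE /D hornerD hornerN horner_sum.
    rewrite (bigD1 x) //= big1 => [|y yx].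
      rewrite addr0 hornerZ /L horner_prod.
      under eq_bigr => y _ do rewrite hornerXsubC.
      by rewrite cE divfK ?subrr.
    rewrite hornerZ /L horner_prod (bigD1 x) 1?eq_sym //=.
    by rewrite hornerXsubC subrr mul0r mulr0.
  - exact/injectiveP.
  - rewrite size_map -cardE card_ord (leq_trans (size_polyD _ _)) // geq_max sR size_polyN.
    rewrite (leq_trans (size_sum _ _ _)) //; apply/bigmax_leqP => x _.
    by rewrite (leq_trans (size_scale_leq _ _)) // sL.
have /eqP := D0; rewrite subr_eq0 => /eqP {1}->.
by rewrite coef_sum; apply: eq_bigr => x _; rewrite coefZ coefL mulr1 cE.
Qed.

(** The remainder R is tracked only through its degree and its top coefficient,
    which is all that interpolation needs. *)
Lemma shifted_prod_XsubC (F : fieldType) p (l : 'I_p -> F) :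
  exists R : {poly F}, [/\ (size R <= p)%N,
    'X * \prod_x ('X - (1 + l x)%:P) = ('X - p%:R%:P) * \prod_x ('X - (l x)%:P) + R
    & R`_p.-1 = 'C(p, 2)%:R - \sum_x l x].
Proof.
elim: p l => [|p IH] l.
  exists 0; rewrite size_poly0 !big_ord0 coef0 !subr0 !mulr1 addr0.
  by split.
have [R [sR ER cR]] := IH (fun x => l (widen_ord (leqnSn p) x)).
set a := l ord_max; set Q := \prod_x ('X - (l (widen_ord (leqnSn p) x))%:P).
have sQ : size Q = p.+1 by rewrite size_prod_XsubC /index_enum -enumT size_enum_ord.
have mQ : Q`_p = 1.
  have /eqP := monic_prod_XsubC (index_enum 'I_p) xpredT (fun x => l (widen_ord (leqnSn p) x)).
  by rewrite lead_coefE -/Q sQ.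
exists ((p%:R - a) *: Q + R * ('X - (1 + a)%:P)); split.
- rewrite (leq_trans (size_polyD _ _)) // geq_max (leq_trans (size_scale_leq _ _)) ?sQ //=.
  rewrite (leq_trans (size_polyMleq _ _)) // size_XsubC; lia.
- rewrite !big_ord_recr /= mulrA ER -/Q -/a -mul_polyC [p.+1%:R]mulrSr !polyCD polyC1 polyCN.
  by ring.
- rewrite /= coefD coefZ mQ mulrBr coefB coefMX coefMC (nth_default 0 sR) mul0r subr0 mulr1.
  rewrite big_ord_recr /= -/a binS bin1 natrD.
  case: p l IH R sR ER cR @a @Q sQ mQ => [|p] l IH R sR ER cR a Q sQ mQ /=.
    by rewrite big_ord0 bin0n /=; ring.
  by rewrite cR; ring.
Qed.

(** At X = l x the polynomial X prod_y (X - 1 - l y) equals both R (l x) and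
    minus the numerator of the summand, so that the sum is minus the top
    coefficient of R. *)
Lemma sum_shifted_ratio (F : fieldType) p (l : 'I_p -> F) : injective l ->
  \sum_x l x * \prod_(y | y != x) ((l x - 1 - l y) / (l x - l y)) =
  \sum_x l x - 'C(p, 2)%:R.
Proof.
move=> l_inj; have [R [sR ER cR]] := shifted_prod_XsubC l.
rewrite -opprB -cR (coef_lagrange l_inj sR) -sumrN; apply: eq_bigr => x _.
rewrite prodf_div mulrA -mulNr; congr (_ / _).
have := congr1 (fun P => P.[l x]) ER; rewrite hornerD !hornerM !horner_prod !hornerXsubC hornerX.
rewrite (bigD1 x) //= [X in _ = _ * X + _](bigD1 x) //= !hornerXsubC subrr mul0r mulr0 add0r => <-.
rewrite [X in - (_ * (_ * X))](eq_bigr (fun y => l x - 1 - l y)); last first.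
  by move=> y _; rewrite hornerXsubC; ring.
by ring.
Qed.

Definition vandermonde (F : fieldType) p (l : 'I_p -> F) : F :=
  \prod_(y : 'I_p) \prod_(x : 'I_p | (x < y)%N) (l y - l x).

(** Only the factors that involve the index x0 change, and the signs coming from
    the orientation of the pairs are the same before and after. *)
Lemma vandermonde_update (F : fieldType) p (l : 'I_p -> F) x0 c : injective l ->
  vandermonde (fun x => if x == x0 then c else l x) =
  vandermonde l * \prod_(y | y != x0) ((c - l y) / (l x0 - l y)).
Proof.
move=> l_inj.
pose A (m : 'I_p -> F) := \prod_(y | y != x0) \prod_(x : 'I_p | (x < y)%N && (x != x0)) (m y - m x).
pose sg (y : 'I_p) : F := if (y < x0)%N then 1 else -1.
have E m : vandermonde m = (\prod_(y | y != x0) sg y) * (\prod_(y | y != x0) (m x0 - m y)) * A m.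
  rewrite /vandermonde (bigD1 x0) //= big_mkcond /= (bigD1 x0) //= ltnn mul1r.
  rewrite /A -!big_split /=; apply: eq_bigr => y yx; rewrite /sg.
  have [lt|gt|/val_inj e] := ltngtP y x0; last by rewrite e eqxx in yx.
    rewrite mul1r; congr (_ * _); apply: eq_bigl => x.
    by have [->|] := eqVneq x x0; rewrite ?andbT // andbF ltnNge ltnW.
  by rewrite (bigD1 x0) //= mul1r mulN1r opprB.
have A_eq : A (fun x => if x == x0 then c else l x) = A l.
  apply: eq_bigr => y yx; apply: eq_bigr => x /andP[_ xx].
  by rewrite (negPf xx) (negPf yx).
rewrite !E A_eq eqxx prodf_div.
have -> : \prod_(y | y != x0) (c - (if y == x0 then c else l y)) = \prod_(y | y != x0) (c - l y).
  by apply: eq_bigr => y /negPf->.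
have nz : \prod_(y | y != x0) (l x0 - l y) != 0.
  by apply/prodf_neq0 => y yx; rewrite subr_eq0 (inj_eq l_inj) eq_sym.
by field.
Qed.

Lemma code_left_max n (v : 'S_n) (x : 'I_n) :
  (forall z : 'I_n, (z < x)%N -> (v z < v x)%N) -> v x = (x + code v x)%N :> nat.
Proof.
move=> H; rewrite -[LHS](card_ord_lt (v x)) -[LHS](card_preimset _ (@perm_inj _ v)).
rewrite -[in RHS](card_ord_lt x) /code -cardsUI.
rewrite [X in (_ + #|pred_of_set X|)%N](_ : _ = set0) ?cards0 ?addn0; last first.
  by apply/setP => z; rewrite !inE; lia.
apply: eq_card => z; rewrite !inE.
have [lt|gt|/val_inj ->] := ltngtP z x; rewrite ?ltnn //=; exact: H.
Qed.

Lemma inversions_eq0 n (v : 'S_n) : inversions v = 0%N -> v = 1%g.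
Proof.
move=> v0; apply/permP => x; rewrite perm1; apply: val_inj.
have := leq_perm_inversions v x; have := leq_inversions_perm v x.
by rewrite v0 /=; lia.
Qed.

Definition grassmannian n p (v : 'S_n) :=
  (forall x y : 'I_n, (x < y < p)%N -> (v x < v y)%N) /\
  (forall x y : 'I_n, (p <= x < y)%N -> (v x < v y)%N).

Lemma grassmannian_code_lt n p (v : 'S_n) (x : 'I_n) : grassmannian p v ->
  (x < p)%N -> v x = (x + code v x)%N :> nat.
Proof. by case=> inc_l _ xp; apply: code_left_max => z zx; apply: inc_l; rewrite zx. Qed.

Lemma grassmannian_code_ge n p (v : 'S_n) (x : 'I_n) : grassmannian p v ->
  (p <= x)%N -> code v x = 0%N.
Proof.
case=> _ inc_r px; apply/eqP; rewrite cards_eq0; apply/eqP/setP => z.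
by rewrite !inE; have := inc_r x z; lia.
Qed.

Lemma sum_widen_ord n p (pn : (p <= n)%N) (G : 'I_n -> nat) :
  (forall y : 'I_n, (p <= y)%N -> G y = 0%N) ->
  (\sum_y G y = \sum_(x < p) G (widen_ord pn x))%N.
Proof.
move=> G0; rewrite -(big_ord_narrow pn) (bigID (fun y : 'I_n => (y < p)%N)) /=.
by rewrite [X in (_ + X)%N]big1 ?addn0 // => y; rewrite -leqNgt; apply: G0.
Qed.

Lemma grassmannian_inversions n p (pn : (p <= n)%N) (v : 'S_n) : grassmannian p v ->
  (\sum_(x < p) v (widen_ord pn x) = inversions v + 'C(p, 2))%N.
Proof.
move=> Gv; rewrite /inversions (sum_widen_ord pn); last first.
  by move=> y; apply: grassmannian_code_ge.
rewrite -bin2_sum big_mkord -big_split /=; apply: eq_bigr => x _.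
by rewrite addnC; apply: (grassmannian_code_lt Gv); exact: (ltn_ord x).
Qed.

Lemma prod_diff_fact (y : nat) : \prod_(0 <= x < y) (y%:R - x%:R) = y`!%:R :> rat.
Proof.
elim: y => [|y IH]; first by rewrite big_nil.
rewrite big_nat_recl // factS natrM subr0 -IH; congr (_ * _); apply: eq_bigr => x _.
by rewrite [y.+1%:R]mulrSr [x.+1%:R]mulrSr; ring.
Qed.

(** This is f / k!, where f is the number of standard Young tableaux of the
    partition with parts l x - x, of weight k. *)
Definition grassmannian_count p (l : 'I_p -> nat) : rat :=
  vandermonde (fun x => (l x)%:R) / \prod_x (l x)`!%:R.

Lemma eq_grassmannian_count p (l l' : 'I_p -> nat) : l =1 l' ->
  grassmannian_count l = grassmannian_count l'.
Proof.
move=> e; congr (_ / _); last by apply: eq_bigr => x _; rewrite e.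
by apply: eq_bigr => y _; apply: eq_bigr => x _; rewrite !e.
Qed.

(** The same quotient is used twice: for the recursion of the next lemma and, at
    the end, to compare the staircase with the staircase minus a corner. *)
Lemma grassmannian_count_dec p (l : 'I_p -> nat) (x0 : 'I_p) : injective l ->
  (0 < l x0)%N ->
  grassmannian_count (fun x => if x == x0 then (l x).-1 else l x) =
  grassmannian_count l * ((l x0)%:R *
    \prod_(y | y != x0) (((l x0)%:R - 1 - (l y)%:R) / ((l x0)%:R - (l y)%:R))).
Proof.
move=> l_inj l0; rewrite /grassmannian_count.
have li : injective (fun x => (l x)%:R : rat).
  by move=> x y /eqP; rewrite eqr_nat => /eqP/l_inj.
have -> : vandermonde (fun x => (if x == x0 then (l x).-1 else l x)%:R : rat) =
    vandermonde (fun x => if x == x0 then (l x0)%:R - 1 else (l x)%:R).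
  apply: eq_bigr => y _; apply: eq_bigr => x _; rewrite -(natrB _ l0) subn1.
  by congr (_ - _); case: eqP => // ->.
rewrite (vandermonde_update _ _ li).
have -> : \prod_x (l x)`!%:R = (l x0)%:R *
    \prod_x (if x == x0 then (l x).-1 else l x)`!%:R :> rat.
  rewrite (bigD1 x0) //= [X in _ = _ * X](bigD1 x0) //= eqxx mulrA -natrM.
  rewrite -{2}(prednK l0) -factS prednK //; congr (_ * _).
  by apply: eq_bigr => x /negPf ->.
have nz1 : (l x0)%:R != 0 :> rat by rewrite pnatr_eq0 -lt0n.
have nz2 : \prod_x (if x == x0 then (l x).-1 else l x)`!%:R != 0 :> rat.
  by apply/prodf_neq0 => x _; rewrite pnatr_eq0 -lt0n fact_gt0.
by field; rewrite nz1 nz2.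
Qed.

(** A letter that is a descent lowers one left value by one.  If the lowered
    value is already taken by another left position, then the letter is not a
    descent and contributes no reduced word; correspondingly the product has a
    zero factor.  So the recursion is the identity sum_shifted_ratio. *)
Lemma grassmannian_num_words n p (pn : (p <= n)%N) k (v : 'S_n) : grassmannian p v ->
  inversions v = k ->
  (num_words k v)%:R = k`!%:R * grassmannian_count (fun x : 'I_p => val (v (widen_ord pn x))).
Proof.
elim: k v => [|k IH] v Gv kv.
  have -> : v = 1%g by apply: inversions_eq0.
  rewrite /= eqxx mul1r (@eq_grassmannian_count _ _ val); last by move=> x; rewrite perm1.
  rewrite /grassmannian_count /vandermonde.
  have -> : \prod_(y < p) \prod_(x < p | (x < y)%N) (y%:R - x%:R) = \prod_(x < p) x`!%:R :> rat.
    apply: eq_bigr => y _; rewrite -prod_diff_fact big_mkord.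
    by rewrite (big_ord_narrow (ltnW (ltn_ord y))).
  rewrite divff //; apply/prodf_neq0 => x _.
  by rewrite pnatr_eq0 -lt0n fact_gt0.
have asc (x y : 'I_n) : (x < y)%N -> v x = (v y).-1 :> nat -> (0 < v y)%N ->
    num_words k (v * adj_tperm (v y))%g = 0%N.
  move=> xy vx vy; apply: num_words_lt.
  by rewrite (inversions_adj vy vx (erefl _) xy) kv.
have val_adj (y z : 'I_n) : (0 < v y)%N -> (v * adj_tperm (v y))%g z =
    (if v z == (v y).-1 :> nat then v y : nat
     else if z == y then (v y).-1 else v z) :> nat.
  by move=> vy; rewrite permM val_adj_tperm // val_eq_perm.
rewrite [num_words _ _]/=.
rewrite (reindex_perm v) /=.
rewrite big_mkcond (sum_widen_ord pn) /=; last first.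
  move=> y py; case: ltnP => // vy.
  pose x := (v^-1)%g (ord_pred (v y)).
  have vx : v x = (v y).-1 :> nat by rewrite permKV val_ord_pred.
  apply: (@asc x y) => //.
  have [yx|//|/val_inj xy] := ltngtP y x; last by move: vx vy; rewrite xy; lia.
  by have := Gv.2 y x; lia.
set l := fun x : 'I_p => val (v (widen_ord pn x)).
have l_inj : injective l by move=> x y /val_inj/perm_inj/(congr1 val) /= /val_inj.
have term x : (if (0 < v (widen_ord pn x))%N then
     num_words k (v * adj_tperm (v (widen_ord pn x)))%g else 0%N)%:R =
   k`!%:R * (grassmannian_count l * ((l x)%:R *
    \prod_(y | y != x) (((l x)%:R - 1 - (l y)%:R) / ((l x)%:R - (l y)%:R)))) :> rat.
  case: posnP => [v0|vx0]; first by rewrite /l /= v0 !(mul0r, mulr0).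
  set x' := widen_ord pn x in vx0 *.
  pose z := (v^-1)%g (ord_pred (v x')).
  have vz : v z = (v x').-1 :> nat by rewrite permKV val_ord_pred.
  have [zp|pz] := ltnP z p.
    have zx : (z < x)%N.
      have [xz|//|xz] := ltngtP x z; first by have := Gv.1 x' z; rewrite xz zp; move=> /(_ isT); lia.
      have e : z = x' by apply: val_inj.
      by move: vz; rewrite e; lia.
    rewrite (asc z) // (bigD1 (Ordinal zp)) /=; last by rewrite -val_eqE /=; lia.
    have -> : l (Ordinal zp) = (v x').-1.
      by rewrite /l -vz; congr (val (v _)); apply: val_inj.
    have e : (l x)%:R = (v x').-1%:R + 1 :> rat by rewrite -mulrSr prednK.
    by rewrite e addrK subrr !(mul0r, mulr0).
  have xz : (x' < z)%N by apply: leq_trans pz; exact: (ltn_ord x).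
  have v'E := val_adj x' _ vx0.
  have nz (y : 'I_n) : (y < p)%N -> (v y == (v x').-1 :> nat) = false.
    by move=> yp; rewrite -vz val_eq_perm -val_eqE /=; lia.
  have ny (y : 'I_n) : (p <= y)%N -> (y == x') = false.
    by move=> py; rewrite -val_eqE /=; have := ltn_ord x; lia.
  rewrite -grassmannian_count_dec // IH.
  - congr (_ * _); apply: eq_grassmannian_count => y.
    rewrite /= v'E nz /=; last exact: (ltn_ord y).
    rewrite -val_eqE /= val_eqE; case: eqP => // ->; by [].
  - split=> a b.
      move=> /andP[ab bp]; rewrite !v'E !nz //; last exact: ltn_trans bp.
      have := Gv.1 a b; rewrite ab bp => /(_ isT).
      have := nz a (ltn_trans ab bp); have := nz b bp.
      by have [->|_] := eqVneq a x'; have [->|_] := eqVneq b x'; lia.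
    move=> /andP[pa ab]; rewrite !v'E !ny //; last exact: leq_trans (ltnW ab).
    have := Gv.2 a b; rewrite pa ab => /(_ isT).
    have := ny a pa; have := ny b (leq_trans pa (ltnW ab)).
    rewrite -!(val_eq_perm v).
    by have [?|?] := eqVneq (v a : nat) (v x').-1; have [?|?] := eqVneq (v b : nat) (v x').-1; lia.
  - apply/eqP; rewrite -eqSS -kv -[X in _ == inversions X](adj_tpermK (v x') v).
    have v'x : (v * adj_tperm (v x'))%g x' = (v x').-1 :> nat.
      by rewrite v'E eqxx; case: eqP; lia.
    have v'z : (v * adj_tperm (v x'))%g z = v x' :> nat by rewrite v'E vz eqxx.
    by rewrite (inversions_adj vx0 v'x v'z xz).
have -> : k.+1`!%:R * grassmannian_count l =
   k`!%:R * grassmannian_count l * (\sum_x (l x)%:R - 'C(p, 2)%:R) :> rat.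
  rewrite -natr_sum (grassmannian_inversions pn Gv) kv natrD addrK factS natrM.
  by ring.
rewrite natr_sum (eq_bigr _ (fun x _ => term x)) -!mulr_sumr mulrA; congr (_ * _) => //.
apply: (@sum_shifted_ratio _ p (fun x => (l x)%:R)).
by move=> x y /eqP; rewrite eqr_nat => /eqP/l_inj.
Qed.

Local Close Scope ring_scope.

(** * Padding by fixed points *)

Section Pad.
Variables (K n L : nat).

Definition pad_fun (v : 'S_n) (x : 'I_(K + (n + L))) : 'I_(K + (n + L)) :=
  match split x with
  | inl _ => x
  | inr y => if split y is inl b then rshift K (lshift L (v b)) else x
  end.

Definition mid (b : 'I_n) : 'I_(K + (n + L)) := rshift K (lshift L b).

Variant pad_spec : 'I_(K + (n + L)) -> Prop :=
  | PadL a : pad_spec (lshift _ a)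
  | PadM b : pad_spec (mid b)
  | PadR c : pad_spec (rshift K (rshift n c)).

Lemma padP x : pad_spec x.
Proof.
case: (split_ordP x) => [a ->|y ->]; first by constructor.
by case: (split_ordP y) => [b ->|c ->]; constructor.
Qed.

Lemma split_l m p (a : 'I_m) : split (lshift p a) = inl a.
Proof. exact: (unsplitK (inl a)). Qed.

Lemma split_r m p (a : 'I_p) : split (rshift m a) = inr a.
Proof. exact: (unsplitK (inr a)). Qed.

Lemma pad_funK (u v : 'S_n) x : pad_fun v (pad_fun u x) = pad_fun (u * v)%g x.
Proof.
rewrite /pad_fun; case: (padP x) => [a|b|c]; rewrite /mid ?split_l ?split_r ?split_l ?split_r //.
by rewrite ?split_l ?split_r permM.
Qed.

Lemma pad_fun1 x : pad_fun 1 x = x.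
Proof.
rewrite /pad_fun; case: (padP x) => [a|b|c]; rewrite /mid ?split_l ?split_r ?split_l ?split_r //.
by rewrite perm1.
Qed.

Lemma pad_inj v : injective (pad_fun v).
Proof.
by apply: (can_inj (g := pad_fun v^-1)) => x; rewrite pad_funK mulgV pad_fun1.
Qed.

Definition pad (v : 'S_n) : 'S_(K + (n + L)) := perm (@pad_inj v).

Lemma pad_mid v b : pad v (mid b) = mid (v b).
Proof. by rewrite permE /pad_fun /mid split_r split_l. Qed.

Lemma pad_out v (x : 'I_(K + (n + L))) : ~~ (K <= x < K + n) -> pad v x = x.
Proof.
rewrite permE /pad_fun; case: (padP x) => [a|b|c]; rewrite /mid ?split_l ?split_r ?split_l ?split_r //=.
by have := ltn_ord b; lia.
Qed.

Lemma midE (x : 'I_(K + (n + L))) : K <= x < K + n -> exists b, x = mid b.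
Proof.
case: (padP x) => [a|b|c] /=; [have := ltn_ord a; lia|by exists b|lia].
Qed.

Lemma pad_in v (x : 'I_(K + (n + L))) : K <= x < K + n -> K <= pad v x < K + n.
Proof. by case/midE=> b ->; rewrite pad_mid /=; have := ltn_ord (v b); lia. Qed.

Lemma mid_inj : injective mid.
Proof. by move=> a b /rshift_inj/lshift_inj. Qed.

Lemma code_mid v b : code (pad v) (mid b) = code v b.
Proof.
rewrite /code -(card_imset _ mid_inj); apply: eq_card => z; rewrite !inE.
apply/idP/imsetP => [/andP[h1 h2]|[c]].
  have hz : K <= z < K + n.
    have [//|/[dup] nz /(pad_out v) e] := boolP (K <= z < K + n).
    move: h1 h2; rewrite e pad_mid /=; move: nz; have := ltn_ord (v b); lia.
  have [c ec] := midE hz; exists c => //; move: h1 h2.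
  by rewrite inE ec !pad_mid /= !ltn_add2l => -> ->.
by rewrite inE => /andP[h1 h2] ->; rewrite !pad_mid /= !ltn_add2l h1 h2.
Qed.

Lemma code_out v (x : 'I_(K + (n + L))) : ~~ (K <= x < K + n) -> code (pad v) x = 0.
Proof.
move=> hx; apply/eqP; rewrite cards_eq0; apply/eqP/setP => z; rewrite !inE (pad_out v hx).
have [hz|/(pad_out v) ->] := boolP (K <= z < K + n); last by move: hx; lia.
by have := pad_in v hz; move: hx hz; lia.
Qed.

Lemma sum_code_pad (a : nat -> nat) v :
  \sum_x a (code (pad v) x) = K * a 0 + \sum_b a (code v b) + L * a 0.
Proof.
rewrite big_split_ord big_split_ord /= addnA; congr (_ + _ + _).
- rewrite (eq_bigr (fun=> a 0)) ?sum_nat_const ?card_ord // => x _.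
  by rewrite code_out //=; have := ltn_ord x; lia.
- by apply: eq_bigr => b _; rewrite -[rshift _ _]/(mid b) code_mid.
- rewrite (eq_bigr (fun=> a 0)) ?sum_nat_const ?card_ord // => x _.
  by rewrite code_out //=; lia.
Qed.

Lemma inversions_pad v : inversions (pad v) = inversions v.
Proof. by rewrite /inversions (sum_code_pad id) !muln0 addn0. Qed.

Lemma pad_adj v (b : 'I_n) : 0 < b -> (pad v * adj_tperm (mid b))%g = pad (v * adj_tperm b)%g.
Proof.
move=> b0; apply/permP => x; apply: val_inj; rewrite permM /= val_adj_tperm /=; last lia.
have [/midE[c ->]|hx] := boolP (K <= x < K + n).
  rewrite !pad_mid /= permM val_adj_tperm //.
  by do ?case: eqP => ?; lia.
by rewrite !pad_out //; have := ltn_ord b; do ?case: eqP => ?; lia.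
Qed.

(** A letter outside the block would create an inversion, so a reduced word of a
    padded permutation only uses letters inside it. *)
Lemma num_words_pad k v : inversions v = k -> num_words k (pad v) = num_words k v.
Proof.
elim: k v => [|k IH] v kv.
  by rewrite (inversions_eq0 kv) (@inversions_eq0 _ (pad 1)) ?inversions_pad ?inversions1 //= !eqxx.
have zero (s : 'I_(K + (n + L))) : 0 < s -> ~~ (K < s < K + n) ->
    num_words k (pad v * adj_tperm s)%g = 0.
  move=> s0 hs; pose x := ((pad v)^-1)%g (ord_pred s); pose y := ((pad v)^-1)%g s.
  have vx : pad v x = s.-1 :> nat by rewrite permKV val_ord_pred.
  have vy : pad v y = s :> nat by rewrite permKV.
  apply: num_words_lt; rewrite (inversions_adj s0 vx vy) ?inversions_pad ?kv //.
  have hx : pad v x = x :> nat \/ K <= x < K + n /\ K <= pad v x < K + n.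
    have [h|h] := boolP (K <= x < K + n); first by right; split=> //; exact: pad_in.
    by left; rewrite pad_out.
  have hy : pad v y = y :> nat \/ K <= y < K + n /\ K <= pad v y < K + n.
    have [h|h] := boolP (K <= y < K + n); first by right; split=> //; exact: pad_in.
    by left; rewrite pad_out.
  by move: hx hy; rewrite vx vy; move: hs; lia.
rewrite [LHS]/= [RHS]/= big_mkcond [RHS]big_mkcond big_split_ord big_split_ord /=.
rewrite big1 ?add0n => [|x _]; last first.
  by case: posnP => // x0; apply: zero => //=; have := ltn_ord x; lia.
rewrite [X in _ + X]big1 ?addn0 => [|x _]; last first.
  by case: posnP => // x0; apply: zero => //=; lia.
apply: eq_bigr => b _; rewrite -[rshift _ _]/(mid b).
have [b0|b0] := posnP b.
  by case: posnP => // x0; apply: zero => //=; lia.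
rewrite ifT; last by rewrite addn_gt0 b0 orbT.
rewrite pad_adj //; have := leq_inversions_adj v b0; rewrite kv ltnS leq_eqVlt.
case/orP=> [/eqP e|lt]; first by rewrite IH.
by rewrite !num_words_lt ?inversions_pad.
Qed.
End Pad.

(** * Permutations that avoid 132 *)

Definition avoids132 n (v : 'S_n) :=
  forall x y z : 'I_n, x < y -> y < z -> ~~ (v x < v z < v y).

Lemma bumpable_pad K n L (v : 'S_n) : avoids132 v -> bumpable K (K + n) (pad K L v).
Proof.
move=> av; split=> [x y /andP[xy yK]|x y /andP[nx xy]|x y z /andP[Kx xy] yn yz].
- by rewrite !pad_out //; lia.
- by rewrite !pad_out //; lia.
have [|b eb] := midE (x := x); first lia.
have [|c ec] := midE (x := y); first lia.
have [/midE[d ed]|hz] := boolP (K <= z < K + n).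
  move: xy yz; rewrite eb ec ed !pad_mid /= !ltn_add2l; exact: av.
have := pad_in v (x := y); rewrite (pad_out v hz); lia.
Qed.

Lemma sorted_map_enum_ord m (f : 'I_m -> nat) :
  (forall x y : 'I_m, x <= y -> f x <= f y) -> sorted leq [seq f x | x <- enum 'I_m].
Proof.
move=> mono; apply: (homo_sorted (e := relpre val leq)); first by move=> x y; apply: mono.
by rewrite -sorted_map val_enum_ord iota_sorted.
Qed.

(** The multisets of values are compared through sums of indicator functions
    because those split along sums of ordinals, as the padded codes do. *)
Lemma mono_eq_sums m (f g : 'I_m -> nat) :
  (forall x y : 'I_m, x <= y -> f x <= f y) -> (forall x y : 'I_m, x <= y -> g x <= g y) ->
  (forall a : pred nat, \sum_x (a (f x) : nat) = \sum_x (a (g x) : nat)) -> f =1 g.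
Proof.
move=> mf mg E x.
have cnt (F : 'I_m -> nat) (a : pred nat) :
    count a [seq F x | x <- enum 'I_m] = \sum_x (a (F x) : nat).
  by rewrite count_map -sum1_count big_mkcond /= big_enum; apply: eq_bigr => i _; case: (a _).
have : [seq f x | x <- enum 'I_m] = [seq g x | x <- enum 'I_m].
  apply: (sorted_eq leq_trans anti_leq); try exact: sorted_map_enum_ord.
  by apply/seq.permP => a; rewrite !cnt.
by move/eq_in_map; apply; rewrite mem_enum.
Qed.

Lemma sum_shifted K n (a : nat -> nat) (h : nat -> nat) : n <= K -> h 0 = 0 ->
  \sum_(x < K) a (h (x + n - K)) = (K - n) * a 0 + \sum_(b < n) a (h (n - 1 - b)).
Proof.
move=> nK h0; rewrite -(big_mkord xpredT (fun x => a (h (x + n - K)))).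
rewrite (@big_cat_nat _ _ _ (K - n)) //=; last lia.
congr (_ + _).
  rewrite (eq_big_nat _ _ (F2 := fun=> a 0)) ?sum_nat_const_nat ?subn0 // => x hx.
  by rewrite (_ : x + n - K = 0) ?h0 //; lia.
rewrite -{1}[K - n]add0n big_addn (_ : K - (K - n) = n); last lia.
rewrite big_mkord (reindex_inj rev_ord_inj) /=; apply: eq_bigr => x _.
by congr (a (h _)); have := ltn_ord x; lia.
Qed.

(** The map h lets the lemma treat rho, with h the identity, and tau_r rho at once:
    in both cases h of the decreasing sequence n-1, ..., 1, 0 is the code, and
    since h is monotone, h of the increasing sequence is the sorted code.  After
    padding and bumping, this sorted code, preceded by zeros, is the code of the
    left part of a Grassmannian permutation. *)
Lemma num_words_avoiding n (v : 'S_n) (h : nat -> nat) K :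
  avoids132 v -> h 0 = 0 -> {homo h : x y / x <= y} ->
  (forall x, code v x = h (n - 1 - x)) ->
  n <= K -> (inversions v).*2 <= K ->
  ((num_words (inversions v) v)%:R =
    (inversions v)`!%:R * grassmannian_count (fun x : 'I_K => (x + h (x + n - K))%N))%R.
Proof.
move=> av h0 mh hv nK NK.
have NM : (K + n + (inversions v).*2 <= K + (n + K))%N by lia.
have := bumpable_grassmannian (leq_addr n K) (@bumpable_pad K n K v av).
rewrite inversions_pad => /(_ NK NM)[v' [t [[inc_l inc_r _] Ev Cv]]].
have Gv : grassmannian K v' by [].
have Iv := code_inversions Cv; rewrite inversions_pad in Iv.
rewrite -(num_words_pad K K (erefl (inversions v))) -Ev.
rewrite (grassmannian_num_words (leq_addr (n + K) K) Gv Iv); congr (_ * _)%R.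
apply: eq_grassmannian_count => x.
have l x' := @grassmannian_code_lt _ _ _ (lshift (n + K) x') Gv (ltn_ord x').
have -> : widen_ord (leq_addr (n + K) K) x = lshift (n + K) x by apply: val_inj.
rewrite [LHS]l /=; congr (_ + _).
apply: (@mono_eq_sums K (fun x => code v' (lshift _ x)) (fun x => h (x + n - K))).
- move=> a b ab; apply: subset_leq_card; apply/subsetP => z; rewrite !inE => /andP[az vz].
  have [/val_inj<-|nab] := eqVneq (a : nat) b; first by rewrite vz andbT.
  have vab : v' (lshift (n + K) a) < v' (lshift (n + K) b).
    by apply: inc_l => /=; have := ltn_ord b; lia.
  have [zK|Kz] := ltnP z K.
    by have := inc_l (lshift (n + K) a) z; rewrite az zK => /(_ isT); lia.
  by have := ltn_ord b; move: vab vz => /=; lia.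
- by move=> a b ab; apply: mh; lia.
move=> a; rewrite (sum_shifted (fun c => a c : nat) nK h0).
have : \sum_x (a (code v' x) : nat) = \sum_x (a (code (pad K K v) x) : nat).
  by rewrite [RHS](reindex_perm t); apply: eq_bigr => x' _; rewrite Cv.
rewrite (sum_code_pad K K (fun c => a c : nat)) big_split_ord /=.
rewrite [X in _ + X = _](eq_bigr (fun=> (a 0 : nat))) => [|x' _]; last first.
  by rewrite (grassmannian_code_ge Gv) //= leq_addr.
rewrite (eq_bigr (fun b : 'I_n => (a (h (n - 1 - b)) : nat)) (fun b _ => congr1 (fun c => a c : nat) (hv b))).
rewrite sum_nat_const card_ord.
have -> : K * a 0 = (K - n) * a 0 + n * a 0 by rewrite -mulnDl subnK.
rewrite mulnDl; lia.
Qed.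

(** * Sorting networks as reduced words *)

Lemma sum_tuple_cons (T : finType) k (G : k.+1.-tuple T -> nat) :
  \sum_w G w = \sum_(s : T) \sum_(w : k.-tuple T) G (cons_tuple s w).
Proof.
rewrite pair_big /= (reindex (fun p : T * k.-tuple T => cons_tuple p.1 p.2)) //=.
exists (fun w => (thead w, behead_tuple w)) => [[s w] _|w _] /=.
  by congr (_, _); apply: val_inj.
by case/tupleP: w => s w; apply: val_inj.
Qed.

Definition spells n (v : 'S_n) (w : seq 'I_n) : bool :=
  all (fun s : 'I_n => 0 < s) w && (word_perm w == v).

Lemma spells_cons n (v : 'S_n) (s : 'I_n) (w : seq 'I_n) :
  spells v (s :: w) = (0 < s) && spells (v * adj_tperm s)%g w.
Proof.
rewrite /spells /= -andbA; congr (_ && (_ && _)).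
rewrite /word_perm rev_cons -cats1 big_cat big_seq1 /=.
by apply/eqP/eqP => [<-|->]; rewrite adj_tpermK.
Qed.

Lemma sum_spells n k (v : 'S_n) :
  \sum_(w : k.-tuple 'I_n) (spells v w : nat) = num_words k v.
Proof.
elim: k v => [|k IH] v.
  rewrite (big_pred1 [tuple]) => [|w]; last by rewrite (tuple0 w) /= eqxx.
  by rewrite /spells /word_perm big_nil /= [v == _]eq_sym.
rewrite sum_tuple_cons /= [RHS]big_mkcond; apply: eq_bigr => s _.
under eq_bigr => w _ do rewrite spells_cons.
by case: ifP => _; [rewrite -IH|rewrite big1].
Qed.

Lemma card_spells_first n k (v : 'S_n) (r : 'I_n) : 0 < r ->
  #|[set w : k.+1.-tuple 'I_n | (head 0 [seq val s | s <- w] == r) && spells v w]|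
  = num_words k (v * adj_tperm r)%g.
Proof.
move=> r0; rewrite -sum1_card big_mkcond sum_tuple_cons (bigD1 r) //=.
rewrite [X in _ + X]big1 ?addn0 => [|s /negPf sr]; last first.
  by rewrite big1 // => w _; rewrite inE /= val_eqE sr.
rewrite -sum_spells; apply: eq_bigr => w _.
by rewrite inE /= eqxx spells_cons r0 /=; case: spells.
Qed.

Lemma card_spells n k (v : 'S_n) :
  #|[set w : k.-tuple 'I_n | spells v w]| = num_words k v.
Proof.
rewrite -sum1_card big_mkcond -sum_spells; apply: eq_bigr => w _.
by rewrite inE; case: spells.
Qed.

(** * The reverse permutation and the staircase *)

Lemma card_ord_ge n a : #|[set z : 'I_n | a <= z]| = n - a.
Proof.
rewrite cardsE -sum1_card -(big_geq_mkord a n xpredT (fun=> 1)) /=.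
by rewrite sum_nat_const_nat muln1.
Qed.

Lemma rev_permE n (x : 'I_n) : rev_perm n x = n - x.+1 :> nat.
Proof. by rewrite permE. Qed.

Lemma rev_adjE n (r x : 'I_n) : 0 < r -> (rev_perm n * adj_tperm r)%g x =
  (if n - x.+1 == r.-1 then r : nat else if n - x.+1 == r then r.-1 else n - x.+1) :> nat.
Proof. by move=> r0; rewrite permM val_adj_tperm // rev_permE. Qed.

Lemma code_rev n (x : 'I_n) : code (rev_perm n) x = n - 1 - x.
Proof.
have -> : n - 1 - x = n - x.+1 by lia.
rewrite -card_ord_ge; apply: eq_card => z; rewrite !inE !rev_permE.
by have := ltn_ord z; lia.
Qed.

(** The values r-1 and r are adjacent in rho; exchanging them lowers the code
    entry r to r-1 and leaves the others alone. *)
Lemma code_rev_adj n (r x : 'I_n) : 0 < r ->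
  code (rev_perm n * adj_tperm r)%g x = (n - 1 - x) - (n - 1 - x == r).
Proof.
move=> r0; have [e|ne] := eqVneq (n - 1 - x) r.
  have -> : n - 1 - x - true = n - x.+2 by lia.
  rewrite -card_ord_ge; apply: eq_card => z; rewrite !inE !rev_adjE //.
  have := ltn_ord z; have := ltn_ord x; do ?case: eqP => ?; lia.
have -> : n - 1 - x - false = n - x.+1 by lia.
rewrite -card_ord_ge; apply: eq_card => z; rewrite !inE !rev_adjE //.
by have := ltn_ord z; have := ltn_ord x; do ?case: eqP => ?; lia.
Qed.

Lemma inversions_rev n : inversions (rev_perm n) = 'C(n, 2).
Proof.
rewrite -bin2_sum big_mkord [RHS](reindex_inj rev_ord_inj) /=.
by apply: eq_bigr => x _; rewrite code_rev; lia.
Qed.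

Lemma inversions_rev_adj n (r : 'I_n) : 0 < r ->
  (inversions (rev_perm n * adj_tperm r)%g).+1 = 'C(n, 2).
Proof.
move=> r0; rewrite -inversions_rev -{2}(adj_tpermK r (rev_perm n)).
set v := (rev_perm n * _)%g.
have rn := ltn_ord r.
have x_lt : n - r.+1 < n by lia.
have y_lt : n - r < n by lia.
rewrite (@inversions_adj _ r v (Ordinal x_lt) (Ordinal y_lt)) //=; try lia.
all: by rewrite rev_adjE //=; do ?case: eqP => ?; lia.
Qed.

Lemma avoids132_rev n : avoids132 (rev_perm n).
Proof. by move=> x y z xy yz; rewrite !rev_permE; lia. Qed.

Lemma avoids132_rev_adj n (r : 'I_n) : 0 < r -> avoids132 (rev_perm n * adj_tperm r)%g.
Proof.
move=> r0 x y z xy yz; rewrite !rev_adjE //.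
by have := ltn_ord z; do ?case: eqP => ?; lia.
Qed.

Local Open Scope ring_scope.

Lemma prod_telescope (A : rat) m : (forall y, (y < m)%N -> A - y%:R != 0) ->
  \prod_(0 <= y < m) ((A - 1 - y%:R) / (A - y%:R)) * A = A - m%:R.
Proof.
elim: m => [|m IH] nz; first by rewrite big_geq // mul1r subr0.
rewrite big_nat_recr //= mulrAC IH => [|y ym]; last by apply: nz; lia.
by rewrite mulrC divfK ?nz // mulrSr; ring.
Qed.

Lemma grassmannian_count_neq0 p (l : 'I_p -> nat) : injective l -> grassmannian_count l != 0.
Proof.
move=> l_inj; rewrite mulf_neq0 ?invr_eq0 //; apply/prodf_neq0 => y _; last first.
  by rewrite pnatr_eq0 -lt0n fact_gt0.
apply/prodf_neq0 => x xy; rewrite subr_eq0 eqr_nat (inj_eq l_inj) -val_eqE /=; lia.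
Qed.

(** The index y runs over K - n leading zero parts, for which the product
    telescopes and turns the factor l x into 2r, and over the parts 0, ..., n-1 of
    the staircase, for which l y = K - n + 2b, so that only the distance of b
    to r matters. *)
Lemma staircase_ratio n r K : (0 < r < n)%N -> (n <= K)%N ->
  let l y := (y + (y + n - K))%N in
  let x := (K - n + r)%N in
  (l x)%:R * \prod_(0 <= y < K | y != x) (((l x)%:R - 1 - (l y)%:R) / ((l x)%:R - (l y)%:R)) =
  ((\prod_(2 <= k < r.+1) (2 * k - 1)%N%:R) *
    (\prod_(2 <= k < (n - r).+1) (2 * k - 1)%N%:R)) /
   ((\prod_(1 <= k < r) (2 * k)%N%:R) *
    (\prod_(1 <= k < n - r) (2 * k)%N%:R)) :> rat.
Proof.
move=> /andP[r0 rn] nK; have [Z ->] : exists Z, K = (Z + n)%N by exists (K - n)%N; lia.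
rewrite addnK => l x.
have lx : l x = (Z + 2 * r)%N by rewrite /l /x; lia.
have [G GE] : exists G : nat -> rat, forall y, G y = ((l x)%:R - 1 - (l y)%:R) / ((l x)%:R - (l y)%:R).
  by exists (fun y => ((l x)%:R - 1 - (l y)%:R) / ((l x)%:R - (l y)%:R)).
under eq_bigr => y _ do rewrite -GE.
have split_prod : \prod_(0 <= y < Z + n | y != x) G y =
    (\prod_(0 <= y < Z) G y) * (\prod_(Z <= y < x) G y) * (\prod_(x.+1 <= y < Z + n) G y).
  rewrite (@big_cat_nat _ _ _ x) //=; last by rewrite /x; lia.
  rewrite [X in _ * X = _]big_ltn_cond; last by rewrite /x; lia.
  rewrite eqxx /=; congr (_ * _).
    rewrite -big_cat_nat //=; last by rewrite /x; lia.
    by apply: congr_big_nat => // y; lia.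
  by apply: congr_big_nat => // y; lia.
(* The zero parts. *)
have T1 : \prod_(0 <= y < Z) G y * (Z + 2 * r)%:R = (2 * r)%:R.
  rewrite (eq_big_nat _ _ (F2 := fun y => ((l x)%:R - 1 - y%:R) / ((l x)%:R - y%:R))).
    rewrite -lx prod_telescope ?lx; first by rewrite natrD addrAC subrr add0r.
    by move=> y yZ; rewrite -natrB ?pnatr_eq0; lia.
  by move=> y yZ; rewrite GE (_ : l y = y) // /l; lia.
(* The parts of the staircase below r. *)
have T2 : \prod_(Z <= y < x) G y =
   (\prod_(2 <= k < r.+1) (2 * k - 1)%N%:R) / (\prod_(1 <= k < r) (2 * k)%N%:R * (2 * r)%:R).
  rewrite -{1}[Z]add0n big_addn /x addnC addnK big_nat_rev /= add0n.
  rewrite (eq_big_nat _ _ (F2 := fun b => (2 * b + 1)%:R / (2 * b.+1)%:R)); last first.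
    move=> b br; rewrite GE lx (_ : l _ = (Z + 2 * (r - b.+1))%N); last by rewrite /l; lia.
    rewrite -natrB; last lia.
    rewrite -addrAC -natrB; last lia.
    rewrite (_ : (Z + 2 * r - (Z + 2 * (r - b.+1)) = (2 * b + 1) + 1)%N); last lia.
    by rewrite natrD addrK; congr (_ / _); rewrite -natrD; congr (_%:R); lia.
  rewrite prodf_div; congr (_ / _).
    rewrite big_add1 /= big_ltn // mulr1n mul1r; apply: eq_big_nat => k _; congr (_%:R); lia.
  by case: r r0 {rn lx T1 split_prod GE} @x => // r _ x; rewrite big_nat_recr //= big_add1.
(* The parts of the staircase above r. *)
have T3 : \prod_(x.+1 <= y < Z + n) G y =
   (\prod_(2 <= k < (n - r).+1) (2 * k - 1)%N%:R) / (\prod_(1 <= k < n - r) (2 * k)%N%:R).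
  rewrite -[x.+1]add1n big_addn (_ : Z + n - x = n - r)%N; last by rewrite /x; lia.
  rewrite [in RHS]big_add1 /= -prodf_div; apply: eq_big_nat => d /andP[d1 dn].
  rewrite GE lx (_ : l _ = (Z + 2 * r + 2 * d)%N); last by rewrite /l /x; lia.
  have d0 : d%:R != 0 :> rat by rewrite pnatr_eq0; lia.
  rewrite (_ : (2 * d.+1 - 1 = 2 * d + 1)%N); last lia.
  rewrite !(natrD, natrM); field; rewrite d0 /=.
  rewrite (_ : _ + _ = - (2 * d%:R)); last ring.
  by rewrite oppr_eq0 mulf_neq0.
have nzr : (2 * r)%:R != 0 :> rat by rewrite pnatr_eq0; lia.
have nzp (a b : nat) : \prod_(a.+1 <= k < b) (2 * k)%:R != 0 :> rat.
  by rewrite prodf_seq_neq0; apply/allP => k; rewrite mem_index_iota pnatr_eq0; lia.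
rewrite split_prod lx !mulrA [_ * \prod_(0 <= y < Z) _]mulrC T1 T2 T3.
have key (a b c d q : rat) : q != 0 -> b != 0 -> d != 0 -> q * (a / (b * q)) * (c / d) = a * c / (b * d).
  by move=> *; field; apply/and3P.
by apply: key.
Qed.

Theorem proposition9 (n r : nat) (r_ge1 : (1 <= r)%N) (r_le : (r <= n - 1)%N) :
  sorting_network_law [set w : 'C(n, 2).-tuple 'I_n | first_letter w == r] =
  1 / ('C(n, 2))%:R *
  (((\prod_(2 <= k < r.+1) (2 * k - 1)%N%:R) *
    (\prod_(2 <= k < (n - r).+1) (2 * k - 1)%N%:R)) /
   ((\prod_(1 <= k < r) (2 * k)%N%:R) *
    (\prod_(1 <= k < n - r) (2 * k)%N%:R))).
Proof.
have rn : (r < n)%N by lia.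
pose s := Ordinal rn; have s0 : (0 < s)%N by [].
pose v := (rev_perm n * adj_tperm s)%g.
have Iv : (inversions v).+1 = 'C(n, 2) := inversions_rev_adj s0.
have -> : sorting_network_law [set w : 'C(n, 2).-tuple 'I_n | first_letter w == r] =
    (num_words (inversions v) v)%:R / (num_words 'C(n, 2) (rev_perm n))%:R.
  rewrite /sorting_network_law /uniform_law -[num_words 'C(n, 2) _]card_spells; congr (_%:R / _).
  rewrite /sorting_networks /first_letter /is_sorting_network; move: 'C(n, 2) Iv => N <-.
  rewrite -[RHS](card_spells_first (inversions v) (rev_perm n) s0).
  by apply: eq_card => w; rewrite !inE.
have [K [nK NK]] : exists K, (n <= K)%N /\ ('C(n, 2).*2 <= K)%N.
  by exists (n + 'C(n, 2).*2)%N; rewrite leq_addr leq_addl.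
pose l (y : 'I_K) := (y + (y + n - K))%N.
have xK : (K - n + r < K)%N by lia.
pose x : 'I_K := Ordinal xK.
have l_inj : injective l by move=> a b /=; rewrite /l => e; apply: val_inj => /=; lia.
have lx0 : (0 < l x)%N by rewrite /l /=; lia.
have -> : (num_words 'C(n, 2) (rev_perm n))%:R = 'C(n, 2)`!%:R * grassmannian_count l.
  rewrite -inversions_rev (num_words_avoiding (h := id) (K := K)) ?inversions_rev //.
  - exact: avoids132_rev.
  - exact: code_rev.
have -> : (num_words (inversions v) v)%:R = (inversions v)`!%:R *
    grassmannian_count (fun y => if y == x then (l y).-1 else l y).
  rewrite (num_words_avoiding (h := fun c => (c - (c == r))%N) (K := K)) //.
  - congr (_ * _); apply: eq_grassmannian_count => y; rewrite -val_eqE /l /=.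
    by do ?case: eqP => ?; lia.
  - exact: avoids132_rev_adj.
  - by move=> a b ab; do ?case: eqP => ?; lia.
  - by move=> y; rewrite code_rev_adj.
  - by lia.
rewrite grassmannian_count_dec // -(staircase_ratio (K := K)) ?r_ge1 //=.
rewrite big_mkord -Iv factS natrM.
have nz1 : (inversions v)`!%:R != 0 :> rat by rewrite pnatr_eq0 -lt0n fact_gt0.
have nz2 : (inversions v).+1%:R != 0 :> rat by rewrite pnatr_eq0.
have nz3 := grassmannian_count_neq0 l_inj.
rewrite -[l x]/(K - n + r + (K - n + r + n - K))%N.
rewrite (eq_bigr (fun y : 'I_K => ((l x)%:R - 1 - (l y)%:R) / ((l x)%:R - (l y)%:R))) //.
have key (a b c d : rat) : a != 0 -> b != 0 -> c != 0 ->
    a * (c * d) / (b * a * c) = 1 / b * d.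
  by move=> *; field; apply/and3P.
by rewrite key.
Qed.
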